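(* Assume $G$ satisfies the Plausibility Assumption. Let $S$ be a set of variables with $|S|\le\zeta\cdot\mathrm{SMALL}$. Then $\mathrm{cl}(S\cup\mathrm{vbls}(\mathrm{cl}(S)))=\mathrm{cl}(S)$.
   Context: Fix integers $K\ge3$, $3\le\tau\le K$. $G$ is a bipartite factor graph between $n$ variable-vertices and constraint-vertices, each constraint-vertex having between $\tau-1$ and $K$ neighbours. A subgraph is an edge-induced subgraph $H=G[A]$ (possibly empty, not necessarily connected); $\mathrm{vbls}(H),\mathrm{cons}(H)$ are its variable-/constraint-vertices, $N_H(f)$ the variables adjacent to $f$ in $H$. $H$ is a $\tau$-subgraph if $|N_H(f)|\ge\tau$ for all $f\in\mathrm{cons}(H)$; a leaf is a variable-vertex of degree $1$ in $H$. Parameters $1\le\mathrm{SMALL}\le n/2$, $0<\zeta<1$, $K\le\zeta\cdot\mathrm{SMALL}$; $H$ is small if $|\mathrm{cons}(H)|\le\mathrm{SMALL}$. For a $\tau$-subgraph $H$: credits $=$ number of leaves; debits $=\sum_{i}\max(\deg_H(i)-2,0)+\sum_{f}(|N_H(f)|-\tau)$; revenue $R(H)=$ credits $-$ debits; income $I(H)=R(H)-\zeta|\mathrm{cons}(H)|$; plausible means $I(H)\ge0$. Plausibility Assumption: every $\tau$-subgraph with at most $2\cdot\mathrm{SMALL}$ constraint-vertices is plausible. For a set $S$ of variables, $H$ is $S$-closed if it is a $\tau$-subgraph all of whose leaves lie in $S$; the closure $\mathrm{cl}(S)$ is the union of all small $S$-closed $\tau$-subgraphs. *)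

(* Defs.v *)
From mathcomp Require Import all_boot all_order all_algebra.

Set Implicit Arguments.
Unset Strict Implicit.
Unset Printing Implicit Defensive.

Import Order.TTheory GRing.Theory Num.Theory.
Local Open Scope ring_scope.

(* A bipartite graph between variable-vertices V and constraint-vertices F is
   its edge set G : {set V * F}.  The edge-induced subgraph G[A] is likewise
   represented by A \subset G, so that its vertices are exactly the endpoints
   of its edges, and unions of subgraphs are unions of edge sets. *)
Section FactorGraph.

Variables V F : finType.
Implicit Types (G H : {set V * F}) (S : {set V}) (i : V) (f : F).

Definition vbls H : {set V} := [set e.1 | e in H].
Definition cons H : {set F} := [set e.2 | e in H].
Definition nbrs H f : {set V} := [set i | (i, f) \in H].
Definition deg H i : nat := #|[set f | (i, f) \in H]|.

Definition factor_graph (K tau : nat) G : Prop :=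
  forall f, (tau - 1 <= #|nbrs G f| <= K)%N.

Definition tau_subgraph (tau : nat) G H : bool :=
  (H \subset G) && [forall f in cons H, (tau <= #|nbrs H f|)%N].

Definition leaves H : {set V} := [set i in vbls H | deg H i == 1%N].

Definition credits H : int := (#|leaves H|)%:Z.

Definition debits (tau : nat) H : int :=
  \sum_(i in vbls H) Num.max ((deg H i)%:Z - 2) 0
  + \sum_(f in cons H) ((#|nbrs H f|)%:Z - tau%:Z).

Definition revenue (tau : nat) H : int := credits H - debits tau H.

Definition S_closed (tau : nat) G S H : bool :=
  tau_subgraph tau G H && (leaves H \subset S).

Section Closure.

Variable R : realFieldType.

Definition income (tau : nat) (zeta : R) H : R :=
  (revenue tau H)%:~R - zeta * #|cons H|%:R.

Definition plausible (tau : nat) (zeta : R) H : bool := 0 <= income tau zeta H.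

Definition small (SMALL : R) H : bool := #|cons H|%:R <= SMALL.

Definition plausibility_assumption (tau : nat) (zeta SMALL : R) G : Prop :=
  forall H, tau_subgraph tau G H -> #|cons H|%:R <= 2 * SMALL ->
    plausible tau zeta H.

Definition cl (tau : nat) (SMALL : R) G S : {set V * F} :=
  \bigcup_(H : {set V * F} | small SMALL H && S_closed tau G S H) H.

End Closure.

End FactorGraph.

(* Main.v *)
Require Import Defs.
From mathcomp Require Import all_boot all_order all_algebra.
Import Order.TTheory GRing.Theory Num.Theory.
Local Open Scope ring_scope.

(** Debits are nonnegative, so a plausible [S]-closed subgraph satisfies
    [zeta * |cons H| <= |leaves H| <= |S| <= zeta * SMALL] and is therefore
    small.  The union of two small [S]-closed subgraphs has at most [2 * SMALL]
    constraints, hence is plausible, hence is again small; so [cl S] is itself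
    small and [S]-closed.  If [H] is small and [(S :|: vbls (cl S))]-closed, a
    leaf of [H :|: cl S] is a leaf of [cl S] or a leaf of [H] outside
    [vbls (cl S)], so it lies in [S]; by the same argument [H :|: cl S] is
    small, and is thus contained in [cl S]. *)

Section Subgraphs.

Set Implicit Arguments.
Unset Strict Implicit.

Variables V F : finType.
Implicit Types (G H : {set V * F}) (S : {set V}) (i : V) (f : F).

Lemma mem_vblsP i H : reflect (exists f, (i, f) \in H) (i \in vbls H).
Proof.
apply: (iffP imsetP) => [[[j f] jfH ->]|[f ifH]]; first by exists f.
by exists (i, f).
Qed.

Lemma consU H1 H2 : cons (H1 :|: H2) = cons H1 :|: cons H2.
Proof. exact: imsetU. Qed.

Lemma subset_nbrs H1 H2 f : H1 \subset H2 -> nbrs H1 f \subset nbrs H2 f.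
Proof. by move=> /subsetP sH; apply/subsetP => i; rewrite !inE; apply: sH. Qed.

(** Degrees can only drop in a subgraph, so the degree of [i] in [H1] is at most 1; being a vertex
    of [H1], it has an edge there. *)
Lemma subset_leaf H1 H2 i :
  H1 \subset H2 -> i \in vbls H1 -> i \in leaves H2 -> i \in leaves H1.
Proof.
move=> /subsetP sH iH1; rewrite !inE iH1 /= => /andP[_ /eqP d2].
rewrite eqn_leq; apply/andP; split.
  by rewrite -d2; apply/subset_leq_card/subsetP => f; rewrite !inE; apply: sH.
by have /mem_vblsP[f ifH] := iH1; apply/card_gt0P; exists f; rewrite inE.
Qed.

Lemma tau_subgraphU (tau : nat) G H1 H2 :
  tau_subgraph tau G H1 -> tau_subgraph tau G H2 ->
  tau_subgraph tau G (H1 :|: H2).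
Proof.
move=> /andP[sH1 /forall_inP t1] /andP[sH2 /forall_inP t2].
apply/andP; split; first by rewrite subUset sH1.
apply/forall_inP => f; rewrite consU inE => /orP[/t1|/t2] tf;
  by apply: leq_trans tf _; rewrite subset_leq_card ?subset_nbrs ?subsetUl ?subsetUr.
Qed.

(** Variables of [C] are harmless as leaves of [H]: they can stay leaves of the union only if they
    are already leaves of [C]. Weakening [S] to [S :|: vbls C] gives the plain union of two
    [S]-closed subgraphs as a special case. *)
Lemma S_closedU_vbls (tau : nat) G S H C :
  S_closed tau G S C -> S_closed tau G (S :|: vbls C) H ->
  S_closed tau G S (H :|: C).
Proof.
move=> /andP[tC /subsetP lC] /andP[tH /subsetP lH].
rewrite /S_closed tau_subgraphU //=; apply/subsetP => i iL.
have [iC|niC] := boolP (i \in vbls C).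
  by apply/lC/(subset_leaf (subsetUr H C)).
have iH : i \in vbls H.
  move: iL; rewrite inE => /andP[/mem_vblsP[f]]; rewrite inE => /orP[] ifU _.
    by apply/mem_vblsP; exists f.
  by case/mem_vblsP: niC; exists f.
by have := lH _ (subset_leaf (subsetUl H C) iH iL); rewrite inE (negPf niC) orbF.
Qed.

Lemma S_closed_mono (tau : nat) G S1 S2 H :
  S1 \subset S2 -> S_closed tau G S1 H -> S_closed tau G S2 H.
Proof. by move=> sS /andP[tH lH]; rewrite /S_closed tH (subset_trans lH). Qed.

Lemma S_closedU (tau : nat) G S H1 H2 :
  S_closed tau G S H1 -> S_closed tau G S H2 -> S_closed tau G S (H1 :|: H2).
Proof.
by move=> c1 c2; apply: S_closedU_vbls c2 (S_closed_mono (subsetUl _ _) c1).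
Qed.

Lemma cons0 : cons (set0 : {set V * F}) = set0.
Proof. exact: imset0. Qed.

Lemma S_closed0 (tau : nat) G S : S_closed tau G S set0.
Proof.
rewrite /S_closed /tau_subgraph sub0set cons0 /=; apply/andP; split.
  by apply/forall_inP => f; rewrite inE.
by rewrite /leaves /vbls imset0; apply/subsetP => i; rewrite !inE.
Qed.

Lemma debits_ge0 (tau : nat) G H : tau_subgraph tau G H -> 0 <= debits tau H.
Proof.
move=> /andP[_ /forall_inP tH]; apply: addr_ge0; apply: sumr_ge0 => x xH.
  by rewrite le_max lexx orbT.
by rewrite subr_ge0 lez_nat tH.
Qed.

Variable R : realFieldType.
Implicit Types zeta SMALL : R.

Lemma plausible_S_closed_cons (tau : nat) zeta G S H :
  S_closed tau G S H -> plausible tau zeta H ->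
  zeta * #|cons H|%:R <= #|S|%:R.
Proof.
move=> /andP[tH lH]; rewrite /plausible /income subr_ge0 => /le_trans; apply.
(* Revenue is an integer cast into [R]; writing [#|S|] as such a cast too moves the comparison to
   [int]. *)
rewrite [leRHS](_ : _ = (#|S|%:Z)%:~R) // ler_int.
apply: (@le_trans _ _ (credits H)); last by rewrite lez_nat subset_leq_card.
by rewrite gerBl (debits_ge0 tH).
Qed.

(** Closedness is asked of the union rather than of its parts, so that [H1] may be closed only for
    the larger set [S :|: vbls H2], as happens in the theorem. *)
Lemma small_S_closedU (tau : nat) zeta SMALL G S H1 H2 :
  0 < zeta -> plausibility_assumption tau zeta SMALL G ->
  #|S|%:R <= zeta * SMALL -> small SMALL H1 -> small SMALL H2 ->
  S_closed tau G S (H1 :|: H2) -> small SMALL (H1 :|: H2).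
Proof.
move=> z0 pG hS s1 s2 cU; rewrite /small -(ler_pM2l z0).
apply: le_trans hS; apply: (plausible_S_closed_cons cU).
apply: pG; first by case/andP: cU.
rewrite mulr_natl mulr2n; apply: le_trans (lerD s1 s2).
by rewrite -natrD ler_nat consU cardsU leq_subr.
Qed.

(** Induction over the big union works because each binary union falls back from the bound
    [2 * SMALL] to [SMALL], so sizes do not accumulate. *)
Lemma cl_small_S_closed (tau : nat) zeta SMALL G S :
  0 < zeta -> 0 <= SMALL -> plausibility_assumption tau zeta SMALL G ->
  #|S|%:R <= zeta * SMALL ->
  small SMALL (cl tau SMALL G S) && S_closed tau G S (cl tau SMALL G S).
Proof.
move=> z0 S0 pG hS; rewrite /cl.
apply: (big_ind (fun H => small SMALL H && S_closed tau G S H)) => //.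
  by rewrite S_closed0 /small cons0 cards0 S0.
move=> H1 H2 /andP[s1 c1] /andP[s2 c2].
have cU := S_closedU c1 c2.
by rewrite cU (small_S_closedU z0 pG hS s1 s2 cU).
Qed.

Lemma cl_sup (tau : nat) SMALL G S H :
  small SMALL H -> S_closed tau G S H -> H \subset cl tau SMALL G S.
Proof. by move=> sH cH; apply: bigcup_sup; rewrite sH. Qed.

End Subgraphs.

Theorem theorem5p9 (R : realFieldType) (K tau n : nat) (V F : finType)
  (G : {set V * F}) (zeta SMALL : R) (S : {set V})
  (hK : (3 <= K)%N) (htau : (3 <= tau <= K)%N)
  (hn : #|V| = n) (hG : factor_graph K tau G)
  (hSMALL : 1 <= SMALL <= n%:R / 2)
  (hzeta : 0 < zeta < 1)
  (hKS : K%:R <= zeta * SMALL)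
  (hplaus : plausibility_assumption tau zeta SMALL G)
  (hS : #|S|%:R <= zeta * SMALL) :
  cl tau SMALL G (S :|: vbls (cl tau SMALL G S)) = cl tau SMALL G S.
Proof.
have [/andP[z0 _] /andP[S1 _]] := (hzeta, hSMALL).
have S0 : 0 <= SMALL := le_trans ler01 S1.
have /andP[sC cC] := cl_small_S_closed z0 S0 hplaus hS.
apply/eqP; rewrite eqEsubset; apply/andP; split; last first.
  by apply: cl_sup sC (S_closed_mono (subsetUl _ _) cC).
apply/bigcupsP => H /andP[sH cH].
have cU := S_closedU_vbls cC cH.
have sU := small_S_closedU z0 hplaus hS sH sC cU.
exact: subset_trans (subsetUl _ _) (cl_sup sU cU).
Qed.
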